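(* Let $G$ be a locally compact, second countable, compactly generated group with left Haar measure $\mu$. Suppose that $G$ has polynomial growth and homogeneous dimension $d_h$. Then for every real $d>d_h$ there exists a continuous, proper, negative type function $\ell:G\to[0,+\infty)$ with polynomial growth such that $$\mu\{s\in G\,|\,\ell(s)\le x\}=O(x^{d}),\qquad x\to+\infty .$$
   Context: Let $K\subset G$ be a compact, symmetric ($K=K^{-1}$) generating set which is a neighborhood of the identity $e\in G$, so that $G=\bigcup_{n\ge1}K^n$ with $K^n=\{s_1\cdots s_n: s_1,\dots,s_n\in K\}$. The group $G$ has polynomial growth if there exist $c,d>0$ such that $\mu(K^n)\le c\,(n+1)^d$ for all $n\ge1$. In that case its homogeneous dimension is $d_h=\limsup_{n\to\infty}\frac{\log\mu(K^n)}{\log n}$. Both the property and $d_h$ are independent of the choice of such a $K$. A negative type (equivalently, negative definite) function is a function $\ell:G\to[0,+\infty)$ with $\ell(e)=0$, $\ell(s^{-1})=\ell(s)$ for all $s\in G$, and $\sum_{i,j=1}^n \overline{c_i}\,c_j\,\ell(s_i^{-1}s_j)\le 0$ for all $n\ge1$, $s_1,\dots,s_n\in G$ and $c_1,\dots,c_n\in\mathbb{C}$ with $\sum_i c_i=0$. A continuous function $\ell$ is proper if $\{s\in G:\ell(s)\le x\}$ is compact for every $x\ge0$. It has polynomial growth if $\mu\{s\in G:\ell(s)\le x\}=O(x^{d'})$ as $x\to+\infty$ for some $d'>0$. *)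

(* Defs.v *)
From HB Require Import structures.
From mathcomp Require Import all_boot all_order all_algebra.
From mathcomp Require Import complex.
From mathcomp Require Import all_classical all_reals all_analysis.

Set Implicit Arguments.
Unset Strict Implicit.
Unset Printing Implicit Defensive.

Import Order.TTheory GRing.Theory Num.Theory.
Import numFieldNormedType.Exports.

Local Open Scope classical_set_scope.
Local Open Scope ring_scope.

HB.mixin Record isTopologicalGroup G & PointedTopological G & Group G := {
  mulg_continuous : continuous (fun x : G * G => (x.1 * x.2)%g);
  invg_continuous : continuous (fun x : G => x^-1%g)
}.

(* The distinguished point carries no mathematical content: it is there because
   the library only builds sigma-algebras on pointed types. *)
#[short(type="topologicalGroupType")]
HB.structure Definition TopologicalGroup :=
  {G of PointedTopological G & Group G & isTopologicalGroup G}.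

Definition borel (G : topologicalGroupType) := g_sigma_algebraType (@open G).

Section definitions.
Context {G : topologicalGroupType}.
Implicit Types (K S : set G).

Definition set_invg S : set G := [set x^-1%g | x in S].

Definition set_expg K (n : nat) : set G :=
  [set (\prod_(i < n) s i)%g | s in [set s : 'I_n -> G | forall i, K (s i)]].

Definition generating_nbhd K :=
  [/\ compact K, set_invg K = K, nbhs (1%g : G) K
    & \bigcup_(n in [set n | (0 < n)%N]) set_expg K n = [set: G]].

Section measure.
Context {R : realType}.
Implicit Types (mu : {measure set (borel G) -> \bar R}) (l : G -> R).

Definition left_invariant mu := forall (s : G) (A : set (borel G)),
  measurable A -> mu [set (s * x)%g | x in A : set G] = mu A.

Definition radon mu :=
  [/\ forall C : set G, compact C -> (mu C < +oo)%E,
      forall A : set (borel G), measurable A ->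
        mu A = ereal_inf [set mu U | U in [set U : set G | open U /\ A `<=` U]]
    & forall U : set G, open U ->
        mu U = ereal_sup [set mu C | C in [set C : set G | compact C /\ C `<=` U]]].

Definition left_haar mu :=
  [/\ radon mu, left_invariant mu & mu [set: G] != 0%E].

Definition polynomial_growth mu :=
  exists2 K : set G, generating_nbhd K &
  exists c d : R, [/\ 0 < c, 0 < d &
    forall n, (0 < n)%N -> (mu (set_expg K n) <= (c * n.+1%:R `^ d)%:E)%E].

(* Neither [polynomial_growth] nor [homogeneous_dimension] depends on the choice
   of K, so a single K suffices as witness. *)
Definition homogeneous_dimension mu (dh : R) :=
  exists2 K : set G, generating_nbhd K &
  limn_esup (fun n : nat =>
    (lne (mu (set_expg K n)) / (ln n%:R)%:E)%E) = dh%:E.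

Definition negative_type l :=
  [/\ forall s, 0 <= l s, l 1%g = 0, forall s, l s^-1%g = l s
    & forall (n : nat) (s : 'I_n -> G) (c : 'I_n -> R[i]),
        (0 < n)%N -> \sum_i c i = 0 ->
        \sum_i \sum_j (c i)^* * c j * (l ((s i)^-1 * s j)%g)%:C%C <= 0].

Definition proper_fun l :=
  forall x : R, 0 <= x -> compact [set s | l s <= x].

(* mu{l <= x} = O(x^d) as x -> +oo, for a possibly infinite mu{l <= x}; the
   library's 'O only compares functions with values in a normed module. *)
Definition sublevel_bigO mu l (d : R) := exists C : R,
  \forall x \near +oo%R, (mu [set s | (l s <= x)%R] <= (C * x `^ d)%:E)%E.

Definition polynomial_growth_fun mu l :=
  exists2 d' : R, 0 < d' & sublevel_bigO mu l d'.

End measure.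
End definitions.

Definition compactly_generated (G : topologicalGroupType) :=
  exists2 S : set G, compact S &
  \bigcup_n set_expg (S `|` set_invg S) n = [set: G].

(* Main.v *)
(* For a compact set B the displacement s |-> mu(sB \ B) is symmetric,
   subadditive, of negative type (it is mu(B) minus a Gram matrix of indicator
   functions) and, by outer regularity, continuous. Since log mu(K^n) grows by
   O(j) over the dyadic block 2^j <= n < 2^(j+1), some n in it is such that,
   with B = K^(n+1), the displacement of any s in K is O(j 2^-j) mu(B). The
   function l is the sum over j of these normalized displacements with weights
   T^j, where T = 2^(e/d) < 2 and d_h < e < d: the series converges uniformly
   on K, hence everywhere by subadditivity. If s lies outside K^(2^(j+2)), then
   sB is disjoint from B and the j-th term alone is T^j; thus {l < T^j} is
   contained in K^(2^(j+2)), of measure O(2^(j e)) = O((T^j)^d). *)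
Require Import Defs.
From HB Require Import structures.
From mathcomp Require Import all_boot all_order all_algebra.
From mathcomp Require Import complex.
From mathcomp Require Import all_classical all_reals all_analysis.
From mathcomp Require Import measurable_realfun ring lra.
Set Implicit Arguments.
Unset Strict Implicit.
Import Order.TTheory GRing.Theory Num.Theory.
Import numFieldNormedType.Exports.
Local Open Scope classical_set_scope.
Local Open Scope ring_scope.

(** * Left translates of sets *)

Section translates.
Context {G : topologicalGroupType}.
Implicit Types (A B K U : set G) (s t x : G) (m n : nat).

Definition ltrans s A : set G := [set (s * x)%g | x in A].

Lemma ltransE s A x : ltrans s A x = A (s^-1 * x)%g.
Proof.
apply/propext; split => [[y Ay <-]|Ax]; first by rewrite mulKg.
by exists (s^-1 * x)%g => //; rewrite mulVKg.
Qed.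

Lemma ltrans1 A : ltrans 1%g A = A.
Proof. by apply/funext => x; rewrite ltransE invg1 mul1g. Qed.

Lemma ltransM s t A : ltrans (s * t)%g A = ltrans s (ltrans t A).
Proof. by apply/funext => x; rewrite !ltransE invgM mulgA. Qed.

Lemma ltransD s A B : ltrans s (A `\` B) = ltrans s A `\` ltrans s B.
Proof. by apply/seteqP; split => x /=; rewrite !ltransE. Qed.

Lemma cvg_mulg (I : Type) (F : set_system I) {FF : Filter F} (f g : I -> G) a b :
  f @ F --> a -> g @ F --> b -> (fun i => f i * g i)%g @ F --> (a * b)%g.
Proof.
move=> fa gb.
exact: (cvg_comp2 (h := fun x y => (x * y)%g) fa gb (mulg_continuous (a, b))).
Qed.

Lemma mulgl_continuous s : continuous (fun x => s * x)%g.
Proof. by move=> x; apply: cvg_mulg; [exact: cvg_cst|exact: cvg_id]. Qed.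

Lemma ltrans_compact s A : compact A -> compact (ltrans s A).
Proof.
move=> cA; apply: continuous_compact => //.
by apply: continuous_subspaceT; exact: mulgl_continuous.
Qed.

Lemma ltrans_open s A : open A -> open (ltrans s A).
Proof.
move=> oA; rewrite (_ : ltrans s A = (fun x => s^-1 * x)%g @^-1` A).
  by apply: open_comp => // x _; exact: mulgl_continuous.
by apply/funext => x; rewrite ltransE.
Qed.

(** A tube argument: around each point of [B] the product stays in [U] for [s] near 1, and
    compactness, in its near-covering form, makes the choice of [s] uniform over [B]. *)
Lemma ltrans_nbhs_compact B U : compact B -> open U -> B `<=` U ->
  \forall s \near (1%g : G), ltrans s B `<=` U.
Proof.
move=> /compact_near_coveringP cB oU BU.
have sBU : \forall s \near (1%g : G), B `<=` (fun x => U (s * x)%g).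
  apply: cB => x Bx; have: nbhs (1 * x)%g U.
    by rewrite mul1g; apply: open_nbhs_nbhs; split => //; exact: BU.
  (* Quantified over all [U], the goal is the convergence of the product map at [(x, 1)]. *)
  move: U {oU BU}.
  change ((fun z : G * G => (z.2 * z.1)%g) @ (x, 1%g) --> (1 * x)%g).
  by apply: cvg_mulg; [exact: cvg_snd|exact: cvg_fst].
by apply: filterS sBU => s sBU _ [x Bx <-]; exact: sBU.
Qed.

End translates.

(** * Powers of a subset of the group *)

Section powers.
Context {G : topologicalGroupType}.
Implicit Types (K : set G) (x y : G) (m n : nat).

Lemma set_expg0 K : set_expg K 0 = [set 1%g].
Proof.
apply/seteqP; split => [_ [s _ <-]|_ ->]; first by rewrite big_ord0.
by exists (fun=> 1%g); [case|rewrite big_ord0].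
Qed.

Lemma set_expgS K n :
  set_expg K n.+1 = [set (z.1 * z.2)%g | z in set_expg K n `*` K].
Proof.
apply/seteqP; split => [_ [s sK <-]|_ [[_ y] /= [[s sK <-] Ky] <-]].
  rewrite big_ord_recr /=; exists (\prod_(i < n) s (widen_ord (leqnSn n) i), s ord_max)%g => //.
  by split => //=; exists (fun i => s (widen_ord (leqnSn n) i)).
(* [unlift ord_max] is [None] exactly at the last index, which receives [y]; the other indices keep
   their factor from [s]. *)
exists (fun i => oapp s y (unlift ord_max i)).
  by move=> i /=; case: unliftP => [j _|_] /=.
rewrite big_ord_recr /= unlift_none /=; congr (_ * _)%g.
apply: eq_bigr => i _; rewrite (_ : widen_ord _ i = lift ord_max i) ?liftK//.
by apply/val_inj; rewrite /= /bump leqNgt ltn_ord.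
Qed.

Lemma set_expg_compact K n : compact K -> compact (set_expg K n).
Proof.
move=> cK; elim: n => [|n IH]; first by rewrite set_expg0; exact: compact_set1.
rewrite set_expgS; apply: continuous_compact; last exact: compact_setX.
apply: continuous_subspaceT; exact: mulg_continuous.
Qed.

Lemma set_expg_mul K m n x y :
  set_expg K m x -> set_expg K n y -> set_expg K (m + n) (x * y)%g.
Proof.
move=> Kx; elim: n y => [|n IH] y; first by rewrite set_expg0 addn0 => ->; rewrite mulg1.
rewrite set_expgS => -[[z t] /= [Kz Kt] <-]; rewrite addnS set_expgS.
by exists (x * z, t)%g => /=; [split => //; exact: IH|rewrite mulgA].
Qed.

Lemma set_expg1 K : set_expg K 1 = K.
Proof.
rewrite set_expgS set_expg0; apply/seteqP; split => [_ [[_ y] /= [-> Ky] <-]|x Kx].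
  by rewrite mul1g.
by exists (1, x)%g; rewrite /= ?mul1g.
Qed.

(** Inversion reverses the order of the factors, so the last one moves to the front: the exponent is
    read as [1 + n]. *)
Lemma set_expgV K n x : set_invg K = K -> set_expg K n x -> set_expg K n x^-1%g.
Proof.
move=> KV; elim: n x => [|n IH] x; first by rewrite set_expg0 => ->; rewrite invg1.
rewrite {1}set_expgS => -[[z t] /= [Kz Kt] <-]; rewrite invgM -add1n.
apply: set_expg_mul; last exact: IH.
by rewrite set_expg1 -KV; exists t.
Qed.

Lemma subset_set_expg K m n : K 1%g -> (m <= n)%N -> set_expg K m `<=` set_expg K n.
Proof.
move=> K1 /subnK <- x Kx; elim: (n - m)%N => // k IH.
by rewrite addSn set_expgS; exists (x, 1%g) => //=; rewrite mulg1.
Qed.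

End powers.

(** * Length functions and negative type *)

Section lengths.
Context {R : realType} {G : topologicalGroupType}.
Implicit Types (l : G -> R).

(** Subadditivity goes beyond the definition of negative type; it is what extends convergence from
    [K] to the group and continuity from the identity to every point. *)
Definition is_length l :=
  [/\ forall s, 0 <= l s, l 1%g = 0, forall s, l s^-1%g = l s
    & forall s t, l (s * t)%g <= l s + l t].

Definition gram_nonpositive l := forall (n : nat) (s : 'I_n -> G) (c : 'I_n -> R),
  \sum_i c i = 0 -> \sum_i \sum_j c i * c j * l ((s i)^-1 * s j)%g <= 0.

Lemma is_lengthZ a l : 0 <= a -> is_length l -> is_length (fun s => a * l s).
Proof.
move=> a0 [l0 l1 lV lM]; split => [s||s|s t].
- by rewrite mulr_ge0.
- by rewrite l1 mulr0.
- by rewrite lV.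
- by rewrite -mulrDr ler_wpM2l.
Qed.

Lemma gram_nonpositiveZ a l :
  0 <= a -> gram_nonpositive l -> gram_nonpositive (fun s => a * l s).
Proof.
move=> a0 lneg n s c c0.
have -> : \sum_i \sum_j c i * c j * (a * l ((s i)^-1 * s j)%g) =
    a * \sum_i \sum_j c i * c j * l ((s i)^-1 * s j)%g.
  rewrite big_distrr /=; apply: eq_bigr => i _; rewrite big_distrr /=.
  by apply: eq_bigr => j _; rewrite mulrCA.
by rewrite mulr_ge0_le0// lneg.
Qed.

(** With [c = a + ib], the real part of the Hermitian sum is the sum of the real forms at [a] and at
    [b]. The order on complex numbers also requires a zero imaginary part, which comes from the
    symmetry of [l]. *)
Lemma negative_type_real l : is_length l -> gram_nonpositive l -> negative_type l.
Proof.
move=> [l0 l1 lV _] lneg; split => // n s c _ c0.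
have ReD : {morph (@complex.Re R) : x y / x + y} by case=> [? ?] [].
have ImD : {morph (@complex.Im R) : x y / x + y} by case=> [? ?] [].
have c0Re : \sum_i complex.Re (c i) = 0.
  by rewrite -(big_morph _ ReD (erefl : complex.Re 0 = 0)) c0.
have c0Im : \sum_i complex.Im (c i) = 0.
  by rewrite -(big_morph _ ImD (erefl : complex.Im 0 = 0)) c0.
rewrite lecE !(big_morph _ ReD (erefl : complex.Re 0 = 0)).
rewrite !(big_morph _ ImD (erefl : complex.Im 0 = 0)) /=.
apply/andP; split.
  (* The imaginary part is a double sum minus the same sum with [i] and [j] exchanged. *)
  under eq_bigr => i _.
    rewrite (big_morph _ ImD (erefl : complex.Im 0 = 0)).
    under eq_bigr => j _.
      rewrite (_ : complex.Im _ = complex.Re (c i) * complex.Im (c j) * l ((s i)^-1 * s j)%g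
         - complex.Re (c j) * complex.Im (c i) * l ((s j)^-1 * s i)%g); last first.
        rewrite -[in X in _ - X]lV invgM invgK; case: (c i) (c j) => [a b] [a' b'] /=; ring.
      over.
    rewrite sumrB; over.
  by rewrite sumrB [X in _ - X]exchange_big /= subrr.
under eq_bigr => i _.
  rewrite (big_morph _ ReD (erefl : complex.Re 0 = 0)).
  under eq_bigr => j _.
    rewrite (_ : complex.Re _ = complex.Re (c i) * complex.Re (c j) * l ((s i)^-1 * s j)%g
         + complex.Im (c i) * complex.Im (c j) * l ((s i)^-1 * s j)%g); last first.
      case: (c i) (c j) => [a b] [a' b'] /=; ring.
    over.
  rewrite big_split; over.
rewrite big_split /= -oppr_ge0 opprD addr_ge0// oppr_ge0; exact: lneg.
Qed.

(** Subadditivity and symmetry give [|l s - l t| <= l (s^-1 * t)], and [s^-1 * t] tends to 1 as [t]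
    tends to [s]. *)
Lemma continuous_length l : is_length l ->
  (forall e, 0 < e -> \forall s \near (1%g : G), l s < e) -> continuous l.
Proof.
move=> [_ _ lV lM] l1 s; apply/cvgrPdist_lt => e e0.
have : (fun t => s^-1 * t)%g @ s --> (1%g : G).
  by rewrite -(mulVg s); exact: mulgl_continuous.
move=> /(_ _ (l1 e e0)) le; have {}le : \forall t \near s, l (s^-1 * t)%g < e by [].
apply: filterS le => t ste.
have ts : l t <= l s + l (s^-1 * t)%g by rewrite -{1}(mulVKg s t).
have st : l s <= l t + l (s^-1 * t)%g.
  by rewrite -[l (s^-1 * t)%g]lV -{1}(mulVKg t s) invgM invgK.
by rewrite ltr_norml; apply/andP; split; lra.
Qed.

End lengths.

(** * Convergent series of length functions *)

Lemma cvg_sumr {R : realType} (n : nat) (f : 'I_n -> nat -> R) (a : 'I_n -> R) :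
  (forall i, f i @ \oo --> a i) ->
  (fun N => \sum_i f i N) @ \oo --> \sum_i a i.
Proof.
move=> fa; have add_cont := @add_continuous R.
exact: (@cvg_big R 'I_n +%R 0 xpredT add_cont _ _ _ f a _ (fun i _ => fa i)).
Qed.

Section length_series.
Context {R : realType} {G : topologicalGroupType}.
Variables (K : set G) (u : nat -> G -> R) (v : nat -> R).
Hypotheses (K1 : nbhs (1%g : G) K)
  (KG : \bigcup_(n in [set n | (0 < n)%N]) set_expg K n = [set: G])
  (u_length : forall j, is_length (u j))
  (u_near1 : forall j e, 0 < e -> \forall s \near (1%g : G), u j s < e)
  (uK : forall j s, K s -> u j s <= v j) (cv : cvgn (series v)).

Definition length_series s : R := limn (series (u ^~ s)).

Let K1' : K 1%g. Proof. exact: nbhs_singleton. Qed.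

Let u_ge0 j s : 0 <= u j s. Proof. by have [+ _ _ _] := u_length j; apply. Qed.

Let v_ge0 j : 0 <= v j. Proof. exact: le_trans (u_ge0 j 1%g) (uK _ K1'). Qed.

(** The majorant [v] is available on [K] only; the general case is an induction on the number of
    factors from [K]. *)
Lemma is_cvg_length_series s : cvgn (series (u ^~ s)).
Proof.
have [n _] : (\bigcup_(n in [set n | (0 < n)%N]) set_expg K n) s by rewrite KG.
elim: n s => [|n IH] s.
  rewrite set_expg0 => ->; apply: series_le_cvg cv => // j; exact: uK.
rewrite set_expgS => -[[x y] [/= Kx Ky] <-].
(* By subadditivity, a further factor from [K] costs at most one more copy of [v]. *)
apply: (series_le_cvg (v_ := u ^~ x + v)) => // [j|j|].
- by rewrite addr_ge0.
- have [_ _ _ uM] := u_length j; apply: le_trans (uM _ _) _.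
  by rewrite lerD2l uK.
- by apply: is_cvg_seriesD => //; exact: IH.
Qed.
#[local] Hint Resolve is_cvg_length_series : core.

Lemma length_series_partial n s : series (u ^~ s) n <= length_series s.
Proof. by apply: nondecreasing_cvgn_le => //; exact: nondecreasing_series. Qed.

Lemma length_series_ge j s : u j s <= length_series s.
Proof.
apply: le_trans (length_series_partial j.+1 s).
by rewrite seriesSr lerDr sumr_ge0.
Qed.

Lemma length_series_length : is_length length_series.
Proof.
have lu j := u_length j; split.
- by move=> s; apply: le_trans (length_series_partial 0 s); rewrite /series /= big_geq.
- rewrite /length_series (_ : u ^~ 1%g = fun=> 0).
    by rewrite (_ : series _ = fun=> 0) ?lim_cst//; apply/funext => n; exact: big1.
  by apply/funext => j; have [] := lu j.
- move=> s; congr (limn (series _)); apply/funext => j.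
  by have [_ _ + _] := lu j; apply.
- move=> s t; rewrite /length_series -lim_seriesD//.
  apply: lim_series_le => // [|j]; first exact: is_cvg_seriesD.
  by have [_ _ _] := lu j; apply.
Qed.

(** On the neighborhood [K] the tail of the series is at most that of [v], hence uniformly small;
    the remaining finitely many terms are small near 1. *)
Lemma length_series_near1 e : 0 < e -> \forall s \near (1%g : G), length_series s < e.
Proof.
move=> e0; have e2 : 0 < e / 2 by rewrite divr_gt0.
have [N _ /(_ N (leqnn N)) vN] : \forall N \near \oo, limn (series v) - series v N < e / 2.
  move/cvgrPdist_lt : cv => /(_ _ e2); apply: filterS => N; apply: le_lt_trans.
  exact: ler_norm.
have partial n d : 0 < d -> \forall s \near (1%g : G), series (u ^~ s) n < d.
  elim: n d => [|n IH] d d0.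
    by apply: nearW => s; rewrite /series /= big_geq.
  have d2 : 0 < d / 2 by rewrite divr_gt0.
  apply: filterS2 (IH _ d2) (u_near1 n d2) => s s1 s2.
  by rewrite seriesSr [ltRHS]splitr ltrD.
apply: filterS2 K1 (partial N _ e2) => s Ks sN.
(* The terms [v - u] are nonnegative on [K], so their partial sums stay below the limit; rearranged,
   this compares the two tails. *)
have : series (v - u ^~ s) N <= limn (series (v - u ^~ s)).
  apply: nondecreasing_cvgn_le; last exact: is_cvg_seriesB.
  by apply: nondecreasing_series => n _ _; rewrite subr_ge0 uK.
rewrite lim_seriesB// seriesD seriesN -/(length_series s) => h.
have {}h : series v N - series (u ^~ s) N <= limn (series v) - length_series s := h.
by rewrite [ltRHS]splitr; lra.
Qed.

(** Each Gram sum is a limit of finite sums of the nonpositive Gram sums of the [u j]. *)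
Lemma length_series_gram :
  (forall j, gram_nonpositive (u j)) -> gram_nonpositive length_series.
Proof.
move=> gu n s c c0.
pose f N := \sum_i \sum_j c i * c j * series (u ^~ ((s i)^-1 * s j)%g) N.
have : f @ \oo --> \sum_i \sum_j c i * c j * length_series ((s i)^-1 * s j)%g.
  pose g i j N := c i * c j * series (u ^~ ((s i)^-1 * s j)%g) N.
  apply: (@cvg_sumr _ _ (fun i N => \sum_j g i j N)) => i.
  apply: (@cvg_sumr _ _ (g i)) => j.
  by apply: cvgM; [exact: cvg_cst|exact: is_cvg_length_series].
move=> /cvgr_to_le; apply; apply: nearW => N.
rewrite (_ : f N = \sum_(0 <= k < N) \sum_i \sum_j c i * c j * u k ((s i)^-1 * s j)%g).
  rewrite -oppr_ge0 -sumrN sumr_ge0// => k _; rewrite oppr_ge0; exact: gu.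
rewrite /f [RHS]exchange_big /=; apply: eq_bigr => i _; rewrite [RHS]exchange_big /=.
by apply: eq_bigr => j _; rewrite big_distrr.
Qed.

End length_series.

(** * Gram matrices of indicator functions *)

Section gram.
Context {d : measure_display} {T : measurableType d} {R : realType}.
Variable mu : {measure set T -> \bar R}.

(** The double sum is the integral of the square of the combination of the indicators of the [A i]
    with coefficients [c i]. *)
Lemma gram_measure_ge0 (n : nat) (A : 'I_n -> set T) (c : 'I_n -> R) :
  (forall i, measurable (A i)) -> (forall i, (mu (A i) < +oo)%E) ->
  0 <= \sum_i \sum_j c i * c j * fine (mu (A i `&` A j)).
Proof.
move=> mA fA.
have mI i j : measurable (A i `&` A j) by exact: measurableI.
have fI i j : (mu (A i `&` A j) < +oo)%E.
  by apply: le_lt_trans (fA i); apply: le_measure; rewrite ?inE//; exact: subIsetl.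
have sqE x : ((\sum_i c i * \1_(A i) x) ^+ 2)%:E
    = (\sum_(p : 'I_n * 'I_n) (c p.1 * c p.2)%:E * (\1_(A p.1 `&` A p.2) x)%:E)%E.
  rewrite sumEFin expr2 big_distrlr /= pair_bigA /=.
  congr (_%:E); apply: eq_bigr => -[i j] _ /=.
  by rewrite indicI mulrACA.
have intI p : mu.-integrable setT (fun x => (\1_(A p.1 `&` A p.2) x)%:E)%E.
  apply/integrableP; split; first by apply/measurable_EFinP; exact: measurable_indic.
  under eq_integral do rewrite gee0_abs ?lee_fin//.
  by rewrite integral_indic// setIT.
have int p : mu.-integrable setT
    (fun x => (c p.1 * c p.2)%:E * (\1_(A p.1 `&` A p.2) x)%:E)%E.
  exact: integrableZl.
have : (0 <= \int[mu]_x ((\sum_i c i * \1_(A i) x) ^+ 2)%:E)%E.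
  by apply: integral_ge0 => x _; rewrite lee_fin sqr_ge0.
under eq_integral do rewrite sqE.
rewrite integral_sum//.
rewrite (eq_bigr (fun p => (c p.1 * c p.2 * fine (mu (A p.1 `&` A p.2)))%:E)).
  by rewrite sumEFin lee_fin pair_bigA.
move=> [i j] _ /=; rewrite integralZl//; last exact: (intI (i, j)).
rewrite integral_indic// setIT [RHS]EFinM fineK//.
by rewrite ge0_fin_numE.
Qed.

End gram.

(** * Displacement of a compact set under Haar measure *)

Section displacement.
Context {R : realType} {G : topologicalGroupType}.
Variable mu : {measure set (borel G) -> \bar R}.
Hypotheses (hausG : hausdorff_space G) (haar_mu : left_haar mu).
Implicit Types (A B C U : set G) (s t : G).

Lemma open_borel U : open U -> measurable (U : set (borel G)).
Proof. by move=> oU; exact: sub_sigma_algebra. Qed.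

Lemma compact_borel C : compact C -> measurable (C : set (borel G)).
Proof.
move=> /(compact_closed hausG) cC; rewrite -(setCK C); apply: measurableC.
by apply: open_borel; exact: closed_openC.
Qed.

Lemma compact_fin_num C : compact C -> mu C \is a fin_num.
Proof. by case: haar_mu => -[muC _ _] _ _ cC; rewrite ge0_fin_numE//; exact: muC. Qed.

Lemma haar_ltrans s A : measurable (A : set (borel G)) -> mu (ltrans s A) = mu A.
Proof. by case: haar_mu => _ + _; apply. Qed.

(** For compact [B] this is half the L1 distance between the indicators of [sB] and [B]. *)
Definition displacement B s : R := fine (mu (ltrans s B `\` B)).

Section compact_set.
Variable B : set G.
Hypothesis cB : compact B.

Let mB s : measurable (ltrans s B : set (borel G)).
Proof. by apply: compact_borel; exact: ltrans_compact. Qed.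

Let mB1 : measurable (B : set (borel G)). Proof. exact: compact_borel. Qed.

(** Translation by [s] turns the set difference into [tB] minus [sB], and [tB] has the measure of
    [B]. The right side is symmetric in [s] and [t] and exhibits the Gram matrix. *)
Lemma displacement_quotient s t : displacement B (s^-1 * t)%g =
  fine (mu B) - fine (mu (ltrans s B `&` ltrans t B)).
Proof.
have fI : mu (ltrans s B `&` ltrans t B) \is a fin_num.
  by apply/compact_fin_num/compact_closedI; [|apply: compact_closed => //];
    exact: ltrans_compact.
have fB := compact_fin_num cB.
rewrite /displacement -(haar_ltrans s) ?ltransD -?ltransM ?mulVKg; last first.
  exact: measurableD.
have tB_lty : (mu (ltrans t B) < +oo)%E.
  by rewrite (haar_ltrans t mB1) -ge0_fin_numE.
have -> : mu (ltrans t B `\` ltrans s B) =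
    (mu (ltrans t B) - mu (ltrans t B `&` ltrans s B))%E.
  exact: measureD (mB t) (mB s) tB_lty.
by rewrite (haar_ltrans t mB1) setIC fineB.
Qed.

Lemma displacementE s : displacement B s =
  fine (mu B) - fine (mu (B `&` ltrans s B)).
Proof. by rewrite -{1}(mul1g s) -{1}invg1 displacement_quotient ltrans1. Qed.

Lemma displacement_ge0 s : 0 <= displacement B s.
Proof. by rewrite fine_ge0. Qed.

Lemma displacement1 : displacement B 1%g = 0.
Proof. by rewrite /displacement ltrans1 setDv measure0. Qed.

Lemma displacementV s : displacement B s^-1%g = displacement B s.
Proof.
by rewrite -(mulg1 s^-1%g) displacement_quotient ltrans1 setIC -displacementE.
Qed.

Let fD s t : mu (ltrans s B `\` ltrans t B) \is a fin_num.
Proof.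
rewrite ge0_fin_numE//; apply: le_lt_trans (_ : mu (ltrans s B) < +oo)%E.
  by apply: le_measure; rewrite ?inE//; exact: measurableD.
by rewrite -ge0_fin_numE//; exact/compact_fin_num/ltrans_compact.
Qed.

(** A point of [stB] outside [B] lies either outside [sB] or in [sB] minus [B]; the first piece is
    the [s]-translate of [tB] minus [B]. *)
Lemma displacementM s t :
  displacement B (s * t)%g <= displacement B s + displacement B t.
Proof.
rewrite /displacement ltransM -(haar_ltrans s (measurableD (mB t) mB1)) ltransD.
rewrite addrC -fineD//; last 2 first.
  by rewrite -ltransM.
  by rewrite -[X in _ `\` X]ltrans1.
apply: fine_le.
- by rewrite -ltransM -[X in _ `\` X]ltrans1.
- rewrite fin_numD -ltransM; apply/andP; split => //.
  by rewrite -[X in _ `\` X]ltrans1.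
have m1 : measurable (ltrans s (ltrans t B) `\` ltrans s B : set (borel G)).
  by rewrite -ltransM; exact: measurableD.
have m2 : measurable (ltrans s B `\` B : set (borel G)) by exact: measurableD.
apply: le_trans (measureU2 mu m1 m2); apply: le_measure; rewrite ?inE.
- by rewrite -ltransM; exact: measurableD.
- exact: measurableU.
by move=> x [xst xB]; have [xs|xs] := pselect (ltrans s B x); [right|left].
Qed.
End compact_set.

Lemma displacement_disjoint B s : compact B ->
  ltrans s B `&` B = set0 -> displacement B s = fine (mu B).
Proof.
move=> cB sBB; rewrite /displacement.
have -> : ltrans s B `\` B = ltrans s B by exact/setDidPl.
by rewrite haar_ltrans//; exact: compact_borel.
Qed.

(** Outer regularity gives an open [U] containing [B] with excess measure below [e]; for [s] near 1
    the translate [sB] is still inside [U]. *)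
Lemma displacement_near1 B (e : R) : compact B -> 0 < e ->
  \forall s \near (1%g : G), displacement B s < e.
Proof.
move=> cB e0; have [[_ outer _] _ _] := haar_mu.
have fB := compact_fin_num cB; have mB := compact_borel cB.
have : (ereal_inf [set mu U | U in [set U : set G | open U /\ B `<=` U]] < mu B + e%:E)%E.
  by rewrite -outer// lteDl.
move=> /ereal_inf_lt[_ [U [oU BU] <-] Ue].
have mU := open_borel oU.
have Uoo : (mu U < +oo)%E.
  by apply: lt_le_trans Ue _; rewrite leey.
have UB : mu (U `\` B) = (mu U - mu B)%E.
  by rewrite (measureD mU mB Uoo) (setIidr BU).
apply: filterS (ltrans_nbhs_compact cB oU BU) => s sBU.
have sUB : (mu (ltrans s B `\` B) <= mu (U `\` B))%E.
  apply: le_measure; rewrite ?inE; last exact: setSD.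
    by apply: measurableD => //; apply: compact_borel; exact: ltrans_compact.
  exact: measurableD.
rewrite -lte_fin fineK; last first.
  rewrite ge0_fin_numE//; apply: le_lt_trans sUB _.
  by apply: le_lt_trans Uoo; apply: le_measure; rewrite ?inE//; exact: measurableD.
by apply: le_lt_trans sUB _; rewrite UB lteBlDl.
Qed.

(* The subtracted term is the Gram matrix of the indicators of the [s i B]. *)
Lemma displacement_gram B (n : nat) (s : 'I_n -> G) (c : 'I_n -> R) :
  compact B -> \sum_i c i = 0 ->
  \sum_i \sum_j c i * c j * displacement B ((s i)^-1 * s j)%g <= 0.
Proof.
move=> cB c0.
have mB i : measurable (ltrans (s i) B : set (borel G)).
  by apply: compact_borel; exact: ltrans_compact.
have fB i : (mu (ltrans (s i) B) < +oo)%E.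
  by rewrite -ge0_fin_numE//; exact/compact_fin_num/ltrans_compact.
have -> : \sum_i \sum_j c i * c j * displacement B ((s i)^-1 * s j)%g =
    (\sum_i c i) * (\sum_j c j) * fine (mu B) -
    \sum_i \sum_j c i * c j * fine (mu (ltrans (s i) B `&` ltrans (s j) B)).
  rewrite big_distrlr /= big_distrl -sumrB /=; apply: eq_bigr => i _.
  rewrite big_distrl -sumrB /=; apply: eq_bigr => j _.
  by rewrite displacement_quotient// mulrBr.
by rewrite c0 !mul0r sub0r oppr_le0; exact: gram_measure_ge0.
Qed.
Lemma displacement_length B : compact B -> is_length (displacement B).
Proof.
move=> cB; split => [s||s|s t].
- exact: displacement_ge0.
- exact: displacement1.
- exact: displacementV.
- exact: displacementM.
Qed.

End displacement.

(** * Slow growth at some scale in each dyadic block *)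

Section slow_growth.
Context {R : realType}.
Variables (V : nat -> R) (C e : R).
Hypotheses (V1 : 0 < V 1%N) (V_homo : {homo V : m n / (m <= n)%N >-> m <= n})
  (C0 : 0 < C) (e0 : 0 <= e) (V_le : forall n, (0 < n)%N -> V n <= C * n%:R `^ e).

Let V_gt0 n : (0 < n)%N -> 0 < V n.
Proof. by move=> n0; apply: lt_le_trans V1 _; exact: V_homo. Qed.

(* Among the [2 ^ j] increments of [ln V] over [2 ^ j, 2 ^ j.+1), one is at most
   the average. *)
Lemma slow_growth_scale : exists A D : R, [/\ 0 <= A, 0 <= D & forall j,
  exists2 n, (2 ^ j <= n < 2 ^ j.+1)%N
    & (V n.+1 - V n) / V n.+1 <= (A + D * j%:R) / 2 ^+ j].
Proof.
(* The increments over the block sum to at most [ln C + e * ln 2 * (j + 1) - ln (V 1)]; the absolute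
   values keep the first constant nonnegative. *)
exists (`|ln C| + `|ln (V 1%N)| + e * ln 2), (e * ln 2).
have ln2 : 0 <= ln (2 : R) by rewrite ln_ge0// ler1n.
split; rewrite ?addr_ge0 ?mulr_ge0// => j.
set b := (_ / _) => /=.
pose r n := ln (V n.+1) - ln (V n).
have [n njr nr] : exists2 n, (2 ^ j <= n < 2 ^ j.+1)%N & r n <= b.
  apply: contrapT => /forall2NP h.
  have rb n : (2 ^ j <= n < 2 ^ j.+1)%N -> b < r n.
    by move=> nj; have [//|] := h n => /negP; rewrite -ltNge.
  have le2 : (2 ^ j <= 2 ^ j.+1)%N by rewrite leq_exp2l.
  have := telescope_sumr (fun n => ln (V n)) le2.
  have : \sum_(2 ^ j <= k < 2 ^ j.+1) b < \sum_(2 ^ j <= k < 2 ^ j.+1) r k.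
    by apply: ltr_sum_nat; rewrite ?ltn_exp2l.
  rewrite sumr_const_nat; have dbl : (2 ^ j.+1 - 2 ^ j = 2 ^ j)%N.
    by rewrite expnS mul2n -addnn addnK.
  rewrite dbl.
  have -> : b *+ 2 ^ j = `|ln C| + `|ln (V 1%N)| + e * ln 2 + e * ln 2 * j%:R.
    by rewrite /b -mulr_natr natrX divfK// expf_neq0.
  rewrite /r => + h2; rewrite h2.
  have Vj : ln (V (2 ^ j.+1)%N) <= ln C + e * ln 2 * j.+1%:R.
    apply: le_trans (_ : ln (C * (2 ^ j.+1)%:R `^ e) <= _).
      by rewrite ler_ln ?posrE ?V_le ?V_gt0 ?expn_gt0// mulr_gt0// powR_gt0// ltr0n expn_gt0.
    rewrite lnM ?posrE ?powR_gt0 ?ltr0n ?expn_gt0// ln_powR natrX lnXn//.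
    by rewrite -[ln 2 *+ _]mulr_natr mulrA.
  have V1j : ln (V 1%N) <= ln (V (2 ^ j)%N).
    by rewrite ler_ln ?posrE ?V_gt0 ?expn_gt0// V_homo// expn_gt0.
  have := ler_norm (ln C); have := ler_norm (- ln (V 1%N)); rewrite normrN.
  move: Vj V1j; rewrite -[j.+1%:R]natr1 mulrDr mulr1.
  generalize (e * ln 2 * j%:R) => z Vj V1j n1 n2 n3; lra.
exists n => //; apply: le_trans nr.
have n0 : (0 < n)%N by case/andP: njr => + _; apply: leq_trans; rewrite expn_gt0.
(* What remains is [1 - y <= - ln y] for [y = V n / V n.+1], an instance of [ln (1 + x) <= x]. *)
rewrite mulrBl divff ?gt_eqF ?V_gt0// /r -lerN2 !opprB.
rewrite -ln_div ?posrE ?V_gt0//.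
have := @le_ln1Dx R (V n / V n.+1 - 1); rewrite [1 + _]addrC subrK; apply.
by rewrite ltrBrDl subrr divr_gt0 ?V_gt0.
Qed.
End slow_growth.

(** * Elementary bounds on geometric sequences *)

Lemma bernoulli_le {R : realType} (h : R) (j : nat) :
  0 <= h -> 1 + h * j%:R <= (1 + h) ^+ j.
Proof.
move=> h0; elim: j => [|j IH]; first by rewrite mulr0 addr0.
rewrite exprS -natr1; apply: le_trans (_ : (1 + h) * (1 + h * j%:R) <= _); last first.
  by rewrite ler_wpM2l// addr_ge0.
have : 0 <= h * (h * j%:R) by rewrite !mulr_ge0.
by move=> ?; nra.
Qed.

Lemma exists_expr_gt {R : realType} (T x : R) : 1 < T -> exists j : nat, x < T ^+ j.
Proof.
move=> T1; have h0 : 0 < T - 1 by rewrite subr_gt0.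
have [j _ /(_ j (leqnn j)) /= xj] := nbhs_infty_gtr (x / (T - 1)).
exists j; rewrite ltr_pdivrMr// mulrC in xj.
have := @bernoulli_le _ (T - 1) j (ltW h0); rewrite [1 + (_ - _)]addrC subrK.
by lra.
Qed.

(** A ratio [p = (1 + h) * q] strictly between [q] and 1 leaves a spare factor [(1 + h) ^+ j], which
    dominates [h * j] by Bernoulli and so absorbs the linear term. *)
Lemma linear_geometric_bound {R : realType} (A D q : R) : 0 <= A -> 0 <= D ->
  0 < q < 1 -> exists M p : R, [/\ 0 <= M, 0 < p < 1 &
  forall j, (A + D * j%:R) * q ^+ j <= M * p ^+ j].
Proof.
move=> A0 D0 /andP[q0 q1].
pose h := (1 - q) / 2 / q; have h0 : 0 < h by rewrite !divr_gt0// subr_gt0.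
have pE : (1 + q) / 2 = (1 + h) * q by rewrite /h; field; rewrite gt_eqF.
exists (A + D / h), ((1 + q) / 2); split => [||j].
- by rewrite addr_ge0// divr_ge0// ltW.
- by apply/andP; split; lra.
rewrite pE exprMn mulrA ler_wpM2r ?exprn_ge0 ?(ltW q0)//.
have bern := bernoulli_le j (ltW h0).
have -> : A + D * j%:R = A + D / h * (h * j%:R) by field; rewrite gt_eqF.
rewrite mulrDl lerD//.
  rewrite ler_peMr// exprn_ege1// lerDl ltW//.
by rewrite ler_wpM2l// ?divr_ge0// ?(ltW h0)//; lra.
Qed.

(** * Volume growth of the powers of [K] *)

Section volume.
Context {R : realType} {G : topologicalGroupType}.
Variables (mu : {measure set (borel G) -> \bar R}) (K : set G).
Hypotheses (hausG : hausdorff_space G) (haar_mu : left_haar mu)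
  (genK : generating_nbhd K).

Lemma generating_nbhd1 : K 1%g.
Proof. by case: genK => _ _ + _; exact: nbhs_singleton. Qed.

(** Finitely many translates of the interior of [K] cover any given compact set. If [K] were null,
    all compact sets would be null, and by inner regularity so would [G]. *)
Lemma haar_gt0 : 0 < fine (mu K).
Proof.
have [cK _ nK _] := genK; have [[_ _ inner] _ muG0] := haar_mu.
have fK := compact_fin_num haar_mu cK; have mK := compact_borel hausG cK.
rewrite lt_neqAle fine_ge0// andbT eq_sym; apply: contra muG0 => /eqP K0.
have {}K0 : mu K = 0%E by rewrite -(fineK fK) K0.
rewrite inner; last exact: openT.
rewrite eq_le; apply/andP; split; last first.
  by apply: ereal_sup_ubound; exists set0; [split => //; exact: compact0|rewrite measure0].
apply: ge_ereal_sup => _ [C [cC _] <-].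
have mC := compact_borel hausG cC.
have [D' _ CD] : finite_subset_cover [set: G] (fun s => ltrans s K°) C.
  move: (cC); rewrite compact_cover; apply.
    by move=> s _; apply: ltrans_open; exact: open_interior.
  by move=> s _; exists s => //; rewrite ltransE mulVg.
have mb s : measurable (ltrans s K : set (borel G)).
  by apply: compact_borel => //; exact: ltrans_compact.
pose S := \big[setU/set0]_(s <- finmap.enum_fset D') (ltrans s K : set (borel G)).
have CS : C `<=` S.
  move=> x /CD [s sD]; rewrite ltransE /S => /interior_subset Ks.
  rewrite -bigcup_seq; by exists s; rewrite ?ltransE.
have mS : measurable S by exact: bigsetU_measurable.
apply: le_trans (_ : (mu S <= _)%E); first by apply: le_measure; rewrite ?inE.
rewrite /S; elim: (finmap.enum_fset D') => [|s r IH]; first by rewrite big_nil measure0.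
rewrite big_cons.
have mr : measurable (\big[setU/set0]_(t <- r) (ltrans t K : set (borel G))).
  exact: bigsetU_measurable.
have mus : (mu (ltrans s K) <= 0)%E by rewrite (haar_ltrans haar_mu s mK) K0.
apply: le_trans (measureU2 mu (mb s) mr) _.
by rewrite -(adde0 0%E); exact: leeD mus IH.
Qed.

Definition volume n : R := fine (mu (set_expg K n)).

Let cK n : compact (set_expg K n).
Proof. by apply: set_expg_compact; case: genK. Qed.

Lemma volumeE n : mu (set_expg K n) = (volume n)%:E.
Proof. by rewrite fineK//; apply: compact_fin_num. Qed.

Lemma volume_homo : {homo volume : m n / (m <= n)%N >-> m <= n}.
Proof.
move=> m n mn; apply: fine_le; try exact: compact_fin_num.
apply: le_measure; rewrite ?inE; try exact: compact_borel.
by apply: subset_set_expg => //; exact: generating_nbhd1.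
Qed.

Lemma volume_gt0 n : (0 < n)%N -> 0 < volume n.
Proof.
move=> n0; apply: lt_le_trans haar_gt0 _.
by rewrite -{1}(set_expg1 K); exact: volume_homo.
Qed.

Section dimension.
Variable dh : R.
Hypothesis dimK :
  limn_esup (fun n => (lne (mu (set_expg K n)) / (ln n%:R)%:E)%E) = dh%:E.

Lemma volume_le_powR e : dh < e -> \forall n \near \oo, volume n <= n%:R `^ e.
Proof.
move=> de; have : (limn_esup (fun n => (lne (mu (set_expg K n)) / (ln n%:R)%:E)%E) < e%:E)%E.
  by rewrite dimK lte_fin.
move=> /ereal_inf_lt[_ [A nA <-] Ae].
apply: filterS2 nA (nbhs_infty_ge 2) => n An n2.
have n0 : (0 < n)%N by exact: leq_trans n2.
have v0 := volume_gt0 n0.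
have lnn : 0 < ln n%:R :> R by rewrite ln_gt0// ltr1n.
have : ((lne (mu (set_expg K n)) / (ln n%:R)%:E) < e%:E)%E.
  by apply: le_lt_trans Ae; apply: ereal_sup_ubound; exists n.
(* Positivity of the volume and of [ln n] selects the finite branches of [lne] and of the extended
   inverse. *)
rewrite volumeE /lne leNgt v0 /= inver gt_eqF// -EFinM lte_fin ltr_pdivrMr// => ve.
rewrite /powR pnatr_eq0 gtn_eqF// -(lnK v0) ler_expR; exact: ltW.
Qed.

(** With [dh < 0] the volumes would be bounded by a negative power of [n] and tend to 0, although
    they are at least [volume 1 > 0]. *)
Lemma dimension_ge0 : 0 <= dh.
Proof.
rewrite leNgt; apply/negP => dh0.
have e0 : dh / 2 < 0 by rewrite pmulr_llt0.
have de : dh < dh / 2 by lra.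
have [N _ hN] := volume_le_powR de.
(* The threshold solves [n ^ (dh / 2) = volume 1]. *)
have [M _ hM] := nbhs_infty_gtr (expR (ln (volume 1) / (dh / 2))).
pose n := maxn (maxn N M) 1.
have n0 : (0 < n)%N by rewrite leq_max orbT.
have /= nN := hN n (leq_trans (leq_maxl N M) (leq_maxl _ 1)).
have /= nM := hM n (leq_trans (leq_maxr N M) (leq_maxl _ 1)).
have : ln (volume 1) <= ln (n%:R `^ (dh / 2)).
  rewrite ler_ln ?posrE ?volume_gt0 ?powR_gt0 ?ltr0n//.
  by apply: le_trans nN; exact: volume_homo.
rewrite ln_powR mulrC -ler_ndivlMr// => h.
have : ln (expR (ln (volume 1) / (dh / 2))) < ln n%:R.
  by rewrite ltr_ln ?posrE ?expR_gt0 ?ltr0n.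
by rewrite expRK ltNge h.
Qed.

(** The indices below the threshold [N] are covered by the constant [volume N], as [n ^ e >= 1] when
    [e > 0]. *)
Lemma volume_le_monomial e : dh < e -> exists2 C, 0 < C &
  forall n, (0 < n)%N -> volume n <= C * n%:R `^ e.
Proof.
move=> de; have e0 : 0 < e by exact: le_lt_trans dimension_ge0 de.
have [N _ hN] := volume_le_powR de.
exists (1 + volume N) => [|n n0]; first by rewrite ltr_pwDl// fine_ge0.
have v0 : 0 <= volume N by rewrite fine_ge0.
have p1 : 1 <= n%:R `^ e :> R.
  by rewrite -[leLHS](powRr0 n%:R) ler_powR// ?ler1n// ltW.
have [Nn|/ltnW nN] := leqP N n.
  apply: le_trans (hN _ Nn) _; rewrite ler_peMl ?powR_ge0// lerDl//.
apply: le_trans (volume_homo nN) _.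
apply: le_trans (_ : (1 + volume N) * 1 <= _); first by rewrite mulr1 lerDr.
by rewrite ler_wpM2l// addr_ge0.
Qed.

End dimension.

(** Since [s^-1] is in [K] as well, [K^n] is contained both in [K^(n+1)] and in its translate by
    [s]. *)
Lemma displacement_le_volume n s : K s ->
  displacement mu (set_expg K n.+1) s <= volume n.+1 - volume n.
Proof.
move=> Ks; rewrite displacementE//  lerD2l lerN2.
have cI : compact (set_expg K n.+1 `&` ltrans s (set_expg K n.+1)).
  by apply: compact_closedI => //; apply: compact_closed => //; exact: ltrans_compact.
apply: fine_le; try exact: compact_fin_num.
apply: le_measure; rewrite ?inE; try exact: compact_borel.
move=> x Kx; split; first by apply: subset_set_expg Kx => //; exact: generating_nbhd1.
rewrite ltransE -add1n; apply: set_expg_mul => //; rewrite set_expg1.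
by case: genK => _ <- _ _; exists s.
Qed.

(** If [x] is in both [sK^n] and [K^n], then [s = x (s^-1 x)^-1] is a product of two elements of
    [K^n]. *)
Lemma displacement_far n s : ~ set_expg K (n + n) s ->
  displacement mu (set_expg K n) s = volume n.
Proof.
move=> ns; apply: displacement_disjoint => //.
rewrite -subset0 => x []; rewrite ltransE => Ksx Kx; apply: ns.
rewrite (_ : s = x * (s^-1 * x)^-1)%g; last by rewrite invgM invgK mulVKg.
by apply: set_expg_mul => //; apply: set_expgV => //; case: genK.
Qed.

End volume.

(** * Construction of the negative type function *)

Unset Implicit Arguments.

Theorem theorem1p1 (R : realType) (G : topologicalGroupType)
    (mu : {measure set (borel G) -> \bar R}) (d_h : R)
    (hausG : hausdorff_space G)
    (lcG : locally_compact [set: G])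
    (scG : @second_countable G)
    (cgG : compactly_generated G)
    (haar_mu : left_haar mu)
    (pgG : polynomial_growth mu)
    (dimG : homogeneous_dimension mu d_h)
    (d : R) (hd : d_h < d) :
  exists l : G -> R,
    [/\ continuous l, proper_fun l, negative_type l,
        polynomial_growth_fun mu l & sublevel_bigO mu l d].
Proof.
have [K genK dimK] := dimG; have [cK _ nK KG] := genK.
have dh0 := dimension_ge0 hausG haar_mu genK dimK.
have d0 : 0 < d by exact: le_lt_trans hd.
pose e := (d_h + d) / 2.
have de : d_h < e by rewrite /e; lra.
have e0 : 0 < e by exact: le_lt_trans de.
pose T : R := 2 `^ (e / d).
have r01 : 0 < e / d < 1 by rewrite divr_gt0//= ltr_pdivrMr// mul1r /e; lra.
have ln2 : 0 < ln (2 : R) by rewrite ln_gt0// ltr1n.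
have T0 : 0 < T by exact: powR_gt0.
have T1 : 1 < T.
  rewrite -ltr_ln ?posrE// ln1 ln_powR; nra.
have T2 : T < 2.
  rewrite -ltr_ln ?posrE// ln_powR; nra.
pose V := volume mu K.
have V_gt0 n : (0 < n)%N -> 0 < V n by exact: volume_gt0.
have [C C0 V_le] := volume_le_monomial hausG haar_mu genK dimK de.
have [A [D [A0 D0 slow]]] :=
  slow_growth_scale (V_gt0 1%N isT) (volume_homo hausG haar_mu genK) C0 (ltW e0) V_le.
(* The strict bound [n < 2 ^ j.+1] leaves room for the exponent [n.+1] of [B j], so that twice this
   exponent is at most [2 ^ j.+2]. *)
have /choice[N N_slow] : forall j, exists n,
    [/\ (0 < n)%N, (n < 2 ^ j.+1)%N & (V n.+1 - V n) / V n.+1 <= (A + D * j%:R) / 2 ^+ j].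
  move=> j; have [n /andP[n1 n2] nb] := slow j; exists n; split => //.
  by apply: leq_trans n1; rewrite expn_gt0.
have q01 : 0 < T / 2 < 1 by apply/andP; split; lra.
have [M [p [M0 /andP[p0 p1] Mp]]] := linear_geometric_bound A0 D0 q01.
pose B j := set_expg K (N j).+1.
have cB j : compact (B j) by exact: set_expg_compact.
pose u j s := T ^+ j / V (N j).+1 * displacement mu (B j) s.
have a0 j : 0 <= T ^+ j / V (N j).+1.
  by rewrite divr_ge0// ?exprn_ge0// ltW// V_gt0.
have u_length j : is_length (u j).
  by apply: is_lengthZ => //; exact: displacement_length.
have u_gram j : gram_nonpositive (u j).
  apply: gram_nonpositiveZ => // n s c c0; exact: displacement_gram.
have u_near1 j r : 0 < r -> \forall s \near (1%g : G), u j s < r.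
  move=> r0; have a1 : 0 < T ^+ j / V (N j).+1 by rewrite divr_gt0// ?exprn_gt0// V_gt0.
  have := displacement_near1 hausG haar_mu (cB j) (divr_gt0 r0 a1).
  by apply: filterS => s; rewrite ltr_pdivlMr// mulrC.
have uK j s : K s -> u j s <= M * p ^+ j.
  move=> Ks; apply: le_trans (Mp j); have [_ _ slow_j] := N_slow j.
  (* The weighted bound is linear in [j] times [(T / 2) ^+ j], hence geometric because [T < 2]. *)
  apply: le_trans (_ : T ^+ j * ((A + D * j%:R) / 2 ^+ j) <= _); last first.
    by rewrite expr_div_n mulrCA.
  apply: le_trans (_ : T ^+ j * ((V (N j).+1 - V (N j)) / V (N j).+1) <= _); last first.
    by rewrite ler_wpM2l// exprn_ge0// ltW.
  rewrite [_ / V _]mulrC mulrA ler_wpM2l//; exact: displacement_le_volume.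
have cv : cvgn (series (fun j => M * p ^+ j)).
  by apply: is_cvg_geometric_series; rewrite gtr0_norm.
pose l := length_series u.
have l_length : is_length l by exact: (length_series_length nK KG u_length uK cv).
have l_cont : continuous l.
  apply: continuous_length => // r r0.
  exact: (length_series_near1 nK KG u_length u_near1 uK cv r0).
have l_far j s : l s < T ^+ j -> set_expg K (2 ^ j.+2) s.
  move=> lj; apply: contrapT => ns; move: lj; apply/negP; rewrite -leNgt.
  apply: le_trans (length_series_ge nK KG u_length uK cv j s).
  rewrite /u displacement_far ?divfK ?gt_eqF ?V_gt0//.
  apply: contra_not ns; apply: subset_set_expg; first exact: nbhs_singleton.
  have [_ Nj _] := N_slow j.
  by rewrite expnS mul2n -addnn leq_add.
have sub_compact x : compact [set s | l s <= x].
  have [j xj] := exists_expr_gt x T1.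
  apply: (@subclosed_compact _ _ (set_expg K (2 ^ j.+2))); last 2 first.
    exact: set_expg_compact.
    by move=> s /= lx; apply: l_far; exact: le_lt_trans xj.
  by apply: (@closed_comp _ _ l [set y | y <= x]) => [s _|]; [exact: l_cont|exact: closed_le].
have bigO : sublevel_bigO mu l d.
  (* [C] comes from the volume bound, [4 ^ e] from [2 ^ j.+2 = 4 * 2 ^ j], and [T ^ d] from
     [T ^+ j <= T * x]. *)
  exists (C * 4 `^ e * T `^ d); near=> x.
  have x1 : 1 <= x by near: x; apply: nbhs_pinfty_ge; rewrite num_real.
  have x0 : 0 <= x by exact: le_trans x1.
  have [j xj jmin] := ex_minnP (exists_expr_gt x T1).
  (* Minimality of [j] gives [T ^+ j.-1 <= x]; the case [j = 0] is excluded by [1 <= x]. *)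
  have jT : T ^+ j <= T * x.
    case: j xj jmin => [|j] xj jmin; first by move: xj; rewrite ltNge x1.
    rewrite exprS ler_pM2l// leNgt; by apply/negP => /jmin; rewrite ltnn.
  apply: le_trans (_ : mu (set_expg K (2 ^ j.+2)) <= _)%E.
    apply: le_measure; rewrite ?inE.
    - by apply: compact_borel => //; exact: sub_compact.
    - by apply: compact_borel => //; exact: set_expg_compact.
    by move=> s /= lx; apply: l_far; exact: le_lt_trans xj.
  rewrite (volumeE haar_mu genK) lee_fin.
  apply: le_trans (V_le _ _) _; first by rewrite expn_gt0.
  rewrite -!mulrA ler_pM2l// -powRM ?(ltW T0)//.
  (* The choice of [T] enters here: [T ^ d = 2 ^ e]. *)
  have -> : (2 ^ j.+2)%:R `^ e = 4 `^ e * (T ^+ j) `^ d.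
    rewrite !expnS mulnA natrM powRM// natrX; congr (_ * _).
    rewrite -powR_mulrn// -powRrM -powR_mulrn ?(ltW T0)// /T -!powRrM; congr (_ `^ _).
    by field; rewrite gt_eqF.
  rewrite ler_pM2l ?powR_gt0// ge0_ler_powR ?nnegrE ?(ltW d0)// ?exprn_ge0 ?mulr_ge0 ?(ltW T0)//.
exists l; split => //.
- by apply: negative_type_real => //; exact: (length_series_gram nK KG u_length uK cv u_gram).
- by exists d.
Unshelve. all: by end_near. Qed.
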